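(* Let $(\Omega,d)$ be a strongly finite-dimensional $*$-differential calculus over a Hopf $*$-algebra $\mathcal{A}$ admitting a Haar integral, and let $\Omega$ be endowed with a graded, left-invariant inner product. Then $d$ is adjointable and $d^*$ is of degree $-1$. Indeed, let $\omega_1,\dots,\omega_M$ be an orthonormal basis of $\Omega^{\mathrm{inv}}_1$ and let $\chi_1,\dots,\chi_M$ be the unique linear functionals on $\mathcal{A}$ such that $da=\sum_{r=1}^M(\chi_r*a)\,\omega_r$ for all $a\in\mathcal{A}$. Then, identifying $\Omega$ with $\mathcal{A}\otimes\Omega^{\mathrm{inv}}$ and writing $\partial$ for the restriction of $d$ to $\Omega^{\mathrm{inv}}$, $$d=\mathrm{id}_{\mathcal{A}}\otimes\partial+\sum_{j=1}^M E_{\chi_j}\otimes M_{\omega_j}$$ and $$d^*=\mathrm{id}_{\mathcal{A}}\otimes\partial^*+\sum_{j=1}^M E_{\chi_j^*}\otimes M_{\omega_j}^*.$$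
   Context: All spaces are over $\mathbb{C}$; inner products are linear in the first variable. $(\mathcal{A},\Delta)$ is a Hopf $*$-algebra with co-inverse (antipode) $\kappa$. A graded $*$-algebra is an algebra $\Omega=\bigoplus_{n\ge 0}\Omega_n$ with $\Omega_m\Omega_n\subseteq\Omega_{m+n}$ and a conjugate-linear degree-zero map $\omega\mapsto\omega^*$ with $(\omega^* )^*=\omega$ and $(\omega_1\omega_2)^*=(-1)^{kl}\omega_2^*\omega_1^*$ for $\omega_1\in\Omega_k,\omega_2\in\Omega_l$. A graded $*$-differential algebra is a pair $(\Omega,d)$ with $\Omega$ a graded $*$-algebra and $d$ a linear map of degree $1$ with $d^2=0$, $d(\omega^* )=(d\omega)^*$ and $d(\omega'\omega)=d(\omega')\omega+(-1)^k\omega'd\omega$ for $\omega'\in\Omega_k$. A $*$-differential calculus over $\mathcal{A}$ is a graded $*$-differential algebra $(\Omega,d)$ such that: (1) $\Omega_0=\mathcal{A}$ as $*$-algebras and $\Omega_k$ ($k>0$) is the linear span of products $a_0\,da_1\cdots da_k$, $a_i\in\mathcal{A}$; (2) there is an algebra homomorphism $\Delta_\Omega:\Omega\to\mathcal{A}\otimes\Omega$ extending $\Delta$ with $(\mathrm{id}_{\mathcal{A}}\otimes d)\Delta_\Omega=\Delta_\Omega d$; (3) $d1=0$. $\Omega^{\mathrm{inv}}=\{\omega:\Delta_\Omega(\omega)=1\otimes\omega\}$ and $\Omega^{\mathrm{inv}}_k=\Omega_k\cap\Omega^{\mathrm{inv}}$. The space $\Omega^{\mathrm{inv}}$ is invariant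 under $d$. The map $a\otimes\omega\mapsto a\omega$ is an isomorphism of left $\mathcal{A}$-modules $\mathcal{A}\otimes\Omega^{\mathrm{inv}}\to\Omega$, used to identify these spaces. The calculus is strongly finite dimensional if $\Omega^{\mathrm{inv}}$ is finite dimensional. A Haar integral is a unital positive linear functional $h$ on $\mathcal{A}$ ($h(a^*a)\ge0$) with $(\mathrm{id}\otimes h)\Delta(a)=(h\otimes\mathrm{id})\Delta(a)=h(a)1$; it is unique and faithful. An inner product on $\Omega$ is graded if the $\Omega_k$ are pairwise orthogonal, and left-invariant if $(a\omega\mid b\eta)=h(b^*a)(\omega\mid\eta)$ for $a,b\in\mathcal{A}$, $\omega,\eta\in\Omega^{\mathrm{inv}}$. For a linear functional $\chi$ on $\mathcal{A}$: $\chi*a=(\mathrm{id}\otimes\chi)\Delta(a)$, $E_\chi(a)=\chi*a$, and $\chi^*(a)=\overline{\chi(\kappa(a)^* )}$. For $\omega\in\Omega_1^{\mathrm{inv}}$, $M_\omega$ is the operator $\eta\mapsto\omega\eta$ on $\Omega^{\mathrm{inv}}$. A linear operator $T$ on an inner product space $X$ is adjointable, with adjoint $T^*$, if there is an operator $T^*$ on $X$ with $(T(x)\mid y)=(x\mid T^*(y))$ for all $x,y\in X$. *)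

(* Defs.v *)
From HB Require Import structures.
From mathcomp Require Import all_boot all_order all_algebra.
From mathcomp Require Import complex boolp reals.

Set Implicit Arguments.
Unset Strict Implicit.
Unset Printing Implicit Defensive.

Import Order.TTheory GRing.Theory Num.Theory.
Local Open Scope ring_scope.
Local Open Scope quotient_scope.

Reserved Notation "x \ox y" (at level 40, left associativity).

(* Tensor products.  Two finite formal sums of pairs (u, v), each standing    *)
(* for u \ox v, are identified when every bilinear map takes the same value   *)
(* on both; tens_liftE and tens_lift_uniq are the usual universal property.   *)
Section Tensor.
Variables (K : numClosedFieldType) (U V : lmodType K).

Definition tens_eval (W : lmodType K) (f : {bilinear U -> V -> W})
  (s : seq (U * V)) : W := \sum_(p <- s) f p.1 p.2.

Definition tens_eqv (s t : seq (U * V)) : bool :=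
  `[< forall (W : lmodType K) (f : {bilinear U -> V -> W}),
        tens_eval f s = tens_eval f t >].

Lemma tens_eqv_refl : reflexive tens_eqv.
Proof. by move=> s; apply/asboolP. Qed.

Lemma tens_eqv_sym : symmetric tens_eqv.
Proof. by move=> s t; apply/asboolP/asboolP => H W f; rewrite H. Qed.

Lemma tens_eqv_trans : transitive tens_eqv.
Proof.
move=> t s u /asboolP H1 /asboolP H2; apply/asboolP => W f.
by rewrite H1 H2.
Qed.

Canonical tens_equiv :=
  EquivRel tens_eqv tens_eqv_refl tens_eqv_sym tens_eqv_trans.

Definition tens : Type := {eq_quot tens_equiv}.
HB.instance Definition _ := Choice.on tens.
HB.instance Definition _ := EqQuotient.on tens.

Definition tens_lift (W : lmodType K) (f : {bilinear U -> V -> W})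
  (x : tens) : W := tens_eval f (repr x).

Lemma tens_lift_pi (W : lmodType K) (f : {bilinear U -> V -> W}) s :
  tens_lift f (\pi_tens s) = tens_eval f s.
Proof.
have /eqmodP/asboolP H : repr (\pi_tens s) = s %[mod tens] by rewrite reprK.
exact: H.
Qed.

Lemma tens_lift_inj x y :
  (forall (W : lmodType K) (f : {bilinear U -> V -> W}),
     tens_lift f x = tens_lift f y) -> x = y.
Proof.
by move=> H; rewrite -[x]reprK -[y]reprK; apply/eqmodP/asboolP.
Qed.

Definition pure_tens (u : U) (v : V) : tens := \pi_tens [:: (u, v)].
Definition tens_zero : tens := \pi_tens [::].
Definition tens_add (x y : tens) : tens := \pi_tens (repr x ++ repr y).
Definition tens_scale (k : K) (x : tens) : tens :=
  \pi_tens [seq (k *: p.1, p.2) | p <- repr x].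
Definition tens_opp (x : tens) : tens := tens_scale (-1) x.

Section Eval.
Variables (W : lmodType K) (f : {bilinear U -> V -> W}).

Lemma tens_lift0 : tens_lift f tens_zero = 0.
Proof. by rewrite tens_lift_pi /tens_eval big_nil. Qed.

Lemma tens_liftD x y :
  tens_lift f (tens_add x y) = tens_lift f x + tens_lift f y.
Proof. by rewrite tens_lift_pi /tens_eval big_cat. Qed.

Lemma tens_liftZ k x : tens_lift f (tens_scale k x) = k *: tens_lift f x.
Proof.
rewrite tens_lift_pi /tens_lift /tens_eval big_map scaler_sumr.
by apply: eq_bigr => p _; rewrite linearZl_LR.
Qed.

Lemma tens_liftE u v : tens_lift f (pure_tens u v) = f u v.
Proof. by rewrite tens_lift_pi /tens_eval big_seq1. Qed.
End Eval.

Lemma tens_addA : associative tens_add.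
Proof. by move=> x y z; apply: tens_lift_inj => W f; rewrite !tens_liftD addrA. Qed.
Lemma tens_addC : commutative tens_add.
Proof. by move=> x y; apply: tens_lift_inj => W f; rewrite !tens_liftD addrC. Qed.
Lemma tens_add0 : left_id tens_zero tens_add.
Proof.
by move=> x; apply: tens_lift_inj => W f; rewrite tens_liftD tens_lift0 add0r.
Qed.
Lemma tens_addN : left_inverse tens_zero tens_opp tens_add.
Proof.
move=> x; apply: tens_lift_inj => W f.
by rewrite tens_liftD tens_liftZ tens_lift0 scaleN1r addNr.
Qed.
HB.instance Definition _ :=
  GRing.isZmodule.Build tens tens_addA tens_addC tens_add0 tens_addN.

Lemma tens_scaleA a b x : tens_scale a (tens_scale b x) = tens_scale (a * b) x.
Proof. by apply: tens_lift_inj => W f; rewrite !tens_liftZ scalerA. Qed.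
Lemma tens_scale1 : left_id 1 tens_scale.
Proof. by move=> x; apply: tens_lift_inj => W f; rewrite tens_liftZ scale1r. Qed.
Lemma tens_scaleDr : right_distributive tens_scale +%R.
Proof.
move=> a x y; apply: tens_lift_inj => W f.
by rewrite !(tens_liftD, tens_liftZ) scalerDr.
Qed.
Lemma tens_scaleDl x : {morph tens_scale^~ x : a b / a + b}.
Proof.
move=> a b; apply: tens_lift_inj => W f.
by rewrite !(tens_liftD, tens_liftZ) scalerDl.
Qed.
HB.instance Definition _ := GRing.Zmodule_isLmodule.Build K tens
  tens_scaleA tens_scale1 tens_scaleDr tens_scaleDl.

Lemma tens_lift_is_linear (W : lmodType K) (f : {bilinear U -> V -> W}) :
  linear (tens_lift f).
Proof.
move=> k x y; rewrite -tens_liftZ; exact: tens_liftD.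
Qed.
HB.instance Definition _ (W : lmodType K) (f : {bilinear U -> V -> W}) :=
  GRing.isLinear.Build K tens W *:%R (tens_lift f) (tens_lift_is_linear f).

Lemma pure_tens_is_bilinear :
  bilinear_for *:%R *:%R pure_tens.
Proof.
split=> [v|u] k x y; apply: tens_lift_inj => W f;
  rewrite linearP /= !tens_liftE.
  by rewrite linearPl.
by rewrite linearPr.
Qed.
HB.instance Definition _ :=
  bilinear_isBilinear.Build K U V tens _ _ pure_tens pure_tens_is_bilinear.

Lemma tens_sum_repr (x : tens) : x = \sum_(p <- repr x) pure_tens p.1 p.2.
Proof.
apply: tens_lift_inj => W f; rewrite linear_sum /=.
by apply: eq_bigr => p _; rewrite tens_liftE.
Qed.

Lemma tens_ind (P : tens -> Prop) :
  P 0 -> (forall x y, P x -> P y -> P (x + y)) ->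
  (forall u v, P (pure_tens u v)) -> forall x, P x.
Proof. by move=> P0 PD Pp x; rewrite [x]tens_sum_repr; elim/big_ind: _. Qed.

Lemma tens_lift_uniq (W : lmodType K) (f g : {linear tens -> W}) :
  (forall u v, f (pure_tens u v) = g (pure_tens u v)) -> f =1 g.
Proof.
move=> H; elim/tens_ind => [|x y Hx Hy|u v]; first by rewrite !linear0.
  by rewrite !linearD Hx Hy.
exact: H.
Qed.

End Tensor.

Arguments tens {K} U V.

Notation "U \ox V" := (tens U%type V%type) : type_scope.
Notation "u \ox v" := (pure_tens u v) : ring_scope.

Section TensorMap.
Variables (K : numClosedFieldType) (U U' V V' : lmodType K).
Variables (f : {linear U -> U'}) (g : {linear V -> V'}).

Definition tens_map_fun (u : U) (v : V) : U' \ox V' := f u \ox g v.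

Lemma tens_map_fun_is_bilinear :
  bilinear_for *:%R *:%R tens_map_fun.
Proof.
by split=> [v|u] k x y; rewrite /tens_map_fun linearP ?linearPl ?linearPr.
Qed.
HB.instance Definition _ := bilinear_isBilinear.Build K U V (tens U' V')
  _ _ tens_map_fun tens_map_fun_is_bilinear.

Definition tens_map : U \ox V -> U' \ox V' := tens_lift tens_map_fun.
HB.instance Definition _ := GRing.Linear.on tens_map.

Lemma tens_mapE u v : tens_map (u \ox v) = f u \ox g v.
Proof. exact: tens_liftE. Qed.
End TensorMap.

Section TensorAssoc.
Variables (K : numClosedFieldType) (U V W : lmodType K).

Definition tens_assoc_fun2 (w : W) (u : U) (v : V) : U \ox (V \ox W) :=
  u \ox (v \ox w).

Lemma tens_assoc_fun2_is_bilinear w :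
  bilinear_for *:%R *:%R (tens_assoc_fun2 w).
Proof. by split=> [v|u] k x y; rewrite /tens_assoc_fun2 ?linearPl ?linearPr. Qed.
HB.instance Definition _ w := bilinear_isBilinear.Build K U V (tens U (tens V W))
  _ _ (tens_assoc_fun2 w) (tens_assoc_fun2_is_bilinear w).

Definition tens_assoc_fun (t : U \ox V) (w : W) : U \ox (V \ox W) :=
  tens_lift (tens_assoc_fun2 w) t.

Lemma tens_assoc_fun_is_bilinear :
  bilinear_for *:%R *:%R tens_assoc_fun.
Proof.
split=> [w|t] k x y; rewrite /tens_assoc_fun; first by rewrite linearP.
elim/tens_ind: t => [|s t Hs Ht|u v].
- by rewrite !linear0 /= scaler0 addr0.
- by rewrite !linearD /= Hs Ht /= !scalerDr addrACA.
- by rewrite !tens_liftE /= /tens_assoc_fun2 linearPr /= linearPr.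
Qed.
HB.instance Definition _ := bilinear_isBilinear.Build K (tens U V) W
  (tens U (tens V W)) _ _ tens_assoc_fun tens_assoc_fun_is_bilinear.

Definition tens_assoc : (U \ox V) \ox W -> U \ox (V \ox W) :=
  tens_lift tens_assoc_fun.
HB.instance Definition _ := GRing.Linear.on tens_assoc.

Lemma tens_assocE u v w : tens_assoc ((u \ox v) \ox w) = u \ox (v \ox w).
Proof. by rewrite /tens_assoc tens_liftE /= /tens_assoc_fun tens_liftE. Qed.
End TensorAssoc.

(* id \ox chi and chi \ox id, followed by U \ox K = U and K \ox U = U.        *)
Section Slices.
Variables (K : numClosedFieldType) (U V : lmodType K).

Definition slicer_fun (chi : {scalar V}) (u : U) (v : V) : U := chi v *: u.
Definition slicel_fun (chi : {scalar U}) (u : U) (v : V) : V := chi u *: v.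

Lemma slicer_fun_is_bilinear chi :
  bilinear_for *:%R *:%R (slicer_fun chi).
Proof.
split=> [v|u] k x y; rewrite /slicer_fun.
  by rewrite /= scalerDr !scalerA mulrC.
by rewrite linearP /= scalerDl scalerA.
Qed.
HB.instance Definition _ chi := bilinear_isBilinear.Build K U V U
  _ _ (slicer_fun chi) (slicer_fun_is_bilinear chi).

Lemma slicel_fun_is_bilinear chi :
  bilinear_for *:%R *:%R (slicel_fun chi).
Proof.
split=> [v|u] k x y; rewrite /slicel_fun.
  by rewrite linearP /= scalerDl scalerA.
by rewrite /= scalerDr !scalerA mulrC.
Qed.
HB.instance Definition _ chi := bilinear_isBilinear.Build K U V V
  _ _ (slicel_fun chi) (slicel_fun_is_bilinear chi).

Definition slicer (chi : {scalar V}) : U \ox V -> U :=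
  tens_lift (slicer_fun chi).
HB.instance Definition _ chi := GRing.Linear.on (slicer chi).
Definition slicel (chi : {scalar U}) : U \ox V -> V :=
  tens_lift (slicel_fun chi).
HB.instance Definition _ chi := GRing.Linear.on (slicel chi).

Lemma slicerE chi u v : slicer chi (u \ox v) = chi v *: u.
Proof. exact: tens_liftE. Qed.
Lemma slicelE chi u v : slicel chi (u \ox v) = chi u *: v.
Proof. exact: tens_liftE. Qed.
End Slices.

(* The multiplication map a \ox b |-> a * b of an algebra, restricted on each *)
(* side along a linear map.                                                   *)
Section TensorProd.
Variables (K : numClosedFieldType) (U V : lmodType K) (B : algType K).
Variables (f : {linear U -> B}) (g : {linear V -> B}).

Definition tens_prod_fun (u : U) (v : V) : B := f u * g v.

Lemma tens_prod_fun_is_bilinear :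
  bilinear_for *:%R *:%R tens_prod_fun.
Proof.
split=> [v|u] k x y; rewrite /tens_prod_fun linearP /=.
  by rewrite mulrDl scalerAl.
by rewrite mulrDr scalerAr.
Qed.
HB.instance Definition _ := bilinear_isBilinear.Build K U V B
  _ _ tens_prod_fun tens_prod_fun_is_bilinear.

Definition tens_prod : U \ox V -> B := tens_lift tens_prod_fun.
HB.instance Definition _ := GRing.Linear.on tens_prod.

Lemma tens_prodE u v : tens_prod (u \ox v) = f u * g v.
Proof. exact: tens_liftE. Qed.
End TensorProd.

(* The algebra A \ox B.  It is only declared a pzRingType, since MathComp's   *)
(* algType asks for 1 != 0; hence the {lrmorphism _ -> _ | *:%R} below.       *)
Section TensorAlgebra.
Variables (K : numClosedFieldType) (A B : algType K).

Definition tens_mul_fun2 (a : A) (b : B) (a' : A) (b' : B) : A \ox B :=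
  (a * a') \ox (b * b').

Lemma tens_mul_fun2_is_bilinear a b :
  bilinear_for *:%R *:%R (tens_mul_fun2 a b).
Proof.
split=> [v|u] k x y; rewrite /tens_mul_fun2 /= mulrDr -scalerAr.
  by rewrite linearPl.
by rewrite linearPr.
Qed.
HB.instance Definition _ a b := bilinear_isBilinear.Build K A B (tens A B)
  _ _ (tens_mul_fun2 a b) (tens_mul_fun2_is_bilinear a b).

Definition tens_mul_fun (y : A \ox B) (a : A) (b : B) : A \ox B :=
  tens_lift (tens_mul_fun2 a b) y.

Lemma tens_mul_fun_is_bilinear t :
  bilinear_for *:%R *:%R (tens_mul_fun t).
Proof.
split=> [b|a] k x y; rewrite /tens_mul_fun;
  elim/tens_ind: t => [|s t Hs Ht|u v].
- by rewrite !linear0 /= scaler0 addr0.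
- by rewrite !linearD /= Hs Ht /= !scalerDr addrACA.
- by rewrite !tens_liftE /= /tens_mul_fun2 mulrDl -scalerAl linearPl.
- by rewrite !linear0 /= scaler0 addr0.
- by rewrite !linearD /= Hs Ht /= !scalerDr addrACA.
- by rewrite !tens_liftE /= /tens_mul_fun2 mulrDl -scalerAl linearPr.
Qed.
HB.instance Definition _ t := bilinear_isBilinear.Build K A B (tens A B)
  _ _ (tens_mul_fun t) (tens_mul_fun_is_bilinear t).

Definition tens_mul (x y : A \ox B) : A \ox B := tens_lift (tens_mul_fun y) x.

Lemma tens_mulE a b a' b' :
  tens_mul (a \ox b) (a' \ox b') = (a * a') \ox (b * b').
Proof. by rewrite /tens_mul tens_liftE /= /tens_mul_fun tens_liftE. Qed.

Lemma tens_mulDl : left_distributive tens_mul +%R.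
Proof. by move=> x y z; rewrite /tens_mul linearD. Qed.

Lemma tens_mulDr : right_distributive tens_mul +%R.
Proof.
move=> x y z; elim/tens_ind: x => [|s t Hs Ht|u v].
- by rewrite /tens_mul !linear0 addr0.
- by rewrite !tens_mulDl Hs Ht addrACA.
- by rewrite /tens_mul !tens_liftE /= /tens_mul_fun linearD.
Qed.

Lemma tens_mul0l x : tens_mul 0 x = 0.
Proof. by rewrite /tens_mul linear0. Qed.

Lemma tens_mul0r x : tens_mul x 0 = 0.
Proof. by apply: (addrI (tens_mul x 0)); rewrite -tens_mulDr !addr0. Qed.

Lemma tens_mulZl k x y : tens_mul (k *: x) y = k *: tens_mul x y.
Proof. by rewrite /tens_mul linearZ. Qed.

Lemma tens_mulZr k x y : tens_mul x (k *: y) = k *: tens_mul x y.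
Proof.
elim/tens_ind: x => [|s t Hs Ht|u v].
- by rewrite !tens_mul0l scaler0.
- by rewrite !tens_mulDl Hs Ht scalerDr.
- by rewrite /tens_mul !tens_liftE /= /tens_mul_fun linearZ.
Qed.

Lemma tens_mulA : associative tens_mul.
Proof.
move=> x y z; elim/tens_ind: x => [|s t Hs Ht|a b].
- by rewrite !tens_mul0l.
- by rewrite !tens_mulDl Hs Ht.
elim/tens_ind: y => [|s t Hs Ht|a' b'].
- by rewrite !(tens_mul0r, tens_mul0l).
- by rewrite !(tens_mulDr, tens_mulDl) Hs Ht.
elim/tens_ind: z => [|s t Hs Ht|a'' b''].
- by rewrite !tens_mul0r.
- by rewrite !tens_mulDr Hs Ht.
by rewrite !tens_mulE !mulrA.
Qed.

Lemma tens_mul1l : left_id (1 \ox 1) tens_mul.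
Proof.
elim/tens_ind => [|s t Hs Ht|a b]; first exact: tens_mul0r.
  by rewrite tens_mulDr Hs Ht.
by rewrite tens_mulE !mul1r.
Qed.

Lemma tens_mul1r : right_id (1 \ox 1) tens_mul.
Proof.
elim/tens_ind => [|s t Hs Ht|a b]; first exact: tens_mul0l.
  by rewrite tens_mulDl Hs Ht.
by rewrite tens_mulE !mulr1.
Qed.

HB.instance Definition _ := GRing.Zmodule_isPzRing.Build (tens A B)
  tens_mulA tens_mul1l tens_mul1r tens_mulDl tens_mulDr.

Lemma pure_tens1 : 1 \ox 1 = 1 :> A \ox B. Proof. by []. Qed.
Lemma pure_tensM (a a' : A) (b b' : B) :
  (a \ox b) * (a' \ox b') = (a * a') \ox (b * b').
Proof. exact: tens_mulE. Qed.
End TensorAlgebra.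

Definition lin_span (K : numClosedFieldType) (X : lmodType K) (P : X -> Prop) (x : X) :=
  exists (n : nat) (c : 'I_n -> K) (v : 'I_n -> X),
    (forall i, P (v i)) /\ x = \sum_(i < n) c i *: v i.

Section Adjoint.
Variables (C : numClosedFieldType) (X : lmodType C) (ip : X -> X -> C).

Definition is_adjoint (T S : X -> X) := forall x y, ip (T x) y = ip x (S y).

Definition adjointable (T : X -> X) :=
  exists S : {linear X -> X}, is_adjoint T S.

(* The adjoint of T, and 0 (a junk value) if T is not adjointable.            *)
Definition adjoint (T : X -> X) : {linear X -> X} :=
  if pselect (adjointable T) is left e then projT1 (cid e)
  else (\0 : {linear X -> X}).

Lemma adjointP (T : X -> X) : adjointable T -> is_adjoint T (adjoint T).
Proof. by rewrite /adjoint; case: pselect => // e _; case: cid. Qed.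
End Adjoint.

(* Conjugate-linear maps are linear maps for the scaling Num.conj \; *:%R.    *)
(* comul_star says Delta(a^* ) = a_1^* \ox a_2^* for any expression           *)
(* Delta(a) = a_1 \ox a_2 (sums understood).                                  *)
Record hopfStarAlg (C : numClosedFieldType) := HopfStarAlg {
  hopf_sort :> algType C;
  star : {linear hopf_sort -> hopf_sort | Num.conj \; *:%R};
  comul : {lrmorphism hopf_sort -> hopf_sort \ox hopf_sort | *:%R};
  counit : {lrmorphism hopf_sort -> C | *%R};
  antipode : {linear hopf_sort -> hopf_sort};
  starK : forall a, star (star a) = a;
  starM : forall a b, star (a * b) = star b * star a;
  comulA : forall a,
    tens_assoc (tens_map comul idfun (comul a)) =
    tens_map idfun comul (comul a);
  counitl : forall a, slicel counit (comul a) = a;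
  counitr : forall a, slicer counit (comul a) = a;
  antipodel : forall a, tens_prod antipode idfun (comul a) = (counit a)%:A;
  antipoder : forall a, tens_prod idfun antipode (comul a) = (counit a)%:A;
  comul_star : forall a (s : seq (hopf_sort * hopf_sort)),
    comul a = \sum_(p <- s) p.1 \ox p.2 ->
    comul (star a) = \sum_(p <- s) star p.1 \ox star p.2
}.

Arguments star {C _}.
Arguments comul {C _}.
Arguments counit {C _}.
Arguments antipode {C _}.

Record is_haar (C : numClosedFieldType) (A : hopfStarAlg C)
    (h : {scalar A}) : Prop := IsHaar {
  haar1 : h 1 = 1;
  haar_ge0 : forall a, 0 <= h (star a * a);
  haar_invr : forall a, slicer h (comul a) = (h a)%:A;
  haar_invl : forall a, slicel h (comul a) = (h a)%:A
}.

Section Functionals.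
Variables (C : numClosedFieldType) (A : hopfStarAlg C) (chi : {scalar A}).

(* conv chi a is chi * a, so that conv chi is E_chi.                          *)
Definition conv (a : A) : A := slicer chi (comul a).

Lemma conv_is_linear : linear conv.
Proof. by move=> k x y; rewrite /conv linearP /= linearP. Qed.
HB.instance Definition _ := GRing.isLinear.Build C A A *:%R conv conv_is_linear.

Definition functional_star (a : A) : C := (chi (star (antipode a)))^*.

Lemma functional_star_is_scalar : scalar functional_star.
Proof.
move=> k x y; rewrite /functional_star linearP linearD linearZ_LR /=.
by rewrite linearP /= rmorphD rmorphM /= conjCK.
Qed.
HB.instance Definition _ := GRing.isLinear.Build C A C *%R
  functional_star functional_star_is_scalar.
End Functionals.

(* The grading is internal: deg k is the subspace Omega_k.  Omega is taken    *)
(* unital: in a calculus the unit of Omega_0 = A is automatically a unit of   *)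
(* Omega, by the spanning condition and d1 = 0.                               *)
Record gradedStarAlg (C : numClosedFieldType) := GradedStarAlg {
  gsa_sort :> algType C;
  deg : nat -> {pred gsa_sort};
  gstar : {linear gsa_sort -> gsa_sort | Num.conj \; *:%R};
  deg_submod : forall k, submod_closed (deg k);
  deg_sum : forall x, exists (n : nat) (y : nat -> gsa_sort),
    (forall k, y k \in deg k) /\ x = \sum_(k < n) y k;
  deg_direct : forall (n : nat) (y : nat -> gsa_sort),
    (forall k, y k \in deg k) -> \sum_(k < n) y k = 0 ->
    forall k, (k < n)%N -> y k = 0;
  degM : forall k l x y,
    x \in deg k -> y \in deg l -> x * y \in deg (k + l)%N;
  deg_star : forall k x, x \in deg k -> gstar x \in deg k;
  gstarK : forall x, gstar (gstar x) = x;
  gstarM : forall k l x y, x \in deg k -> y \in deg l ->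
    gstar (x * y) = (-1) ^+ (k * l) * (gstar y * gstar x)
}.

Arguments deg {C} _ _.
Arguments gstar {C} _.

Record gradedStarDiffAlg (C : numClosedFieldType) := GradedStarDiffAlg {
  gsda_alg :> gradedStarAlg C;
  diff : {linear gsda_alg -> gsda_alg};
  deg_diff : forall k x, x \in deg gsda_alg k -> diff x \in deg gsda_alg k.+1;
  diffK : forall x, diff (diff x) = 0;
  diff_star : forall x, diff (gstar gsda_alg x) = gstar gsda_alg (diff x);
  diffM : forall k x y, x \in deg gsda_alg k ->
    diff (x * y) = diff x * y + (-1) ^+ k * (x * diff y)
}.

Arguments diff {C} _.

(* The equality Omega_0 = A is an isomorphism emb of *-algebras from A onto   *)
(* Omega_0.                                                                   *)
Record starCalculus (C : numClosedFieldType) (A : hopfStarAlg C) :=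
    StarCalculus {
  calc_alg :> gradedStarDiffAlg C;
  emb : {lrmorphism A -> calc_alg};
  emb_inj : injective emb;
  emb_deg0 : forall x, x \in deg calc_alg 0%N <-> exists a, x = emb a;
  emb_star : forall a, emb (star a) = gstar calc_alg (emb a);
  deg_span : forall k x, (0 < k)%N -> x \in deg calc_alg k <->
    lin_span (fun y => exists (a : A) (b : 'I_k -> A),
                y = emb a * \prod_(j < k) diff calc_alg (emb (b j))) x;
  coact : {lrmorphism calc_alg -> A \ox calc_alg | *:%R};
  coact_emb : forall a, coact (emb a) = tens_map idfun emb (comul a);
  coact_diff : forall x,
    tens_map idfun (diff calc_alg) (coact x) = coact (diff calc_alg x);
  diff1 : diff calc_alg 1 = 0
}.

Arguments emb {C A} _.
Arguments coact {C A} _.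

Section Invariants.
Variables (C : numClosedFieldType) (A : hopfStarAlg C) (Om : starCalculus A).

Definition inv_pred : {pred Om} := [pred x : Om | coact Om x == 1 \ox x].

Lemma inv_predP (x : Om) : reflect (coact Om x = 1 \ox x) (x \in inv_pred).
Proof. exact: eqP. Qed.

Lemma inv_pred_submod : submod_closed inv_pred.
Proof.
split=> [|k x y /inv_predP Hx /inv_predP Hy]; apply/inv_predP.
  by rewrite linear0 linear0r.
by rewrite linearP /= Hx Hy linearPr.
Qed.
HB.instance Definition _ := GRing.isSubmodClosed.Build C Om inv_pred
  (GRing.submod_closed_semi inv_pred_submod).

Record inv_form : Type := Inv { inv_val : Om; _ : inv_val \in inv_pred }.
HB.instance Definition _ := [isSub for inv_val].
HB.instance Definition _ := [Choice of inv_form by <:].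
HB.instance Definition _ := [SubChoice_isSubLmodule of inv_form by <:].
HB.instance Definition _ := GRing.isLinear.Build C inv_form Om *:%R inv_val
  (linearP (val : {linear inv_form -> Om})).

Lemma inv_valP (x : inv_form) : coact Om (inv_val x) = 1 \ox inv_val x.
Proof. exact/inv_predP/valP. Qed.

Lemma inv_diff_subproof (x : inv_form) : diff Om (inv_val x) \in inv_pred.
Proof. by apply/inv_predP; rewrite -coact_diff (inv_valP x) tens_mapE. Qed.
Definition inv_diff (x : inv_form) : inv_form := Inv (inv_diff_subproof x).

Lemma inv_diff_is_linear : linear inv_diff.
Proof. by move=> k x y; apply: val_inj; rewrite /= linearP. Qed.
HB.instance Definition _ :=
  GRing.isLinear.Build C inv_form inv_form *:%R inv_diff inv_diff_is_linear.

(* inv_mul w is M_w, for an invariant form w.                                 *)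
Lemma inv_mul_subproof (w x : inv_form) : inv_val w * inv_val x \in inv_pred.
Proof.
apply/inv_predP.
by rewrite rmorphM /= (inv_valP w) (inv_valP x) pure_tensM mul1r.
Qed.
Definition inv_mul (w x : inv_form) : inv_form := Inv (inv_mul_subproof w x).

Lemma inv_mul_is_linear w : linear (inv_mul w).
Proof.
by move=> k x y; apply: val_inj; rewrite /= mulrDr scalerAr.
Qed.
HB.instance Definition _ w :=
  GRing.isLinear.Build C inv_form inv_form *:%R (inv_mul w) (inv_mul_is_linear w).

(* The map A \ox Omega^inv -> Omega, a \ox w |-> a w.                         *)
Definition inv_iso : A \ox inv_form -> Om :=
  tens_prod (emb Om) inv_val.
HB.instance Definition _ := GRing.Linear.on inv_iso.

Definition strongly_fd := exists s : seq inv_form,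
  forall x, lin_span (fun y => y \in s) x.

Section InnerProduct.
Variable ip : {dot Om for Num.conj}.

Definition graded_ip := forall k l (x y : Om),
  x \in deg Om k -> y \in deg Om l -> k != l -> ip x y = 0.

Definition left_invariant_ip (h : {scalar A}) :=
  forall (a b : A) (w e : inv_form),
    ip (emb Om a * inv_val w) (emb Om b * inv_val e) =
    h (star b * a) * ip (inv_val w) (inv_val e).

Definition inv_ip (x y : inv_form) : C := ip (inv_val x) (inv_val y).

Definition inv1_orthonormal_basis (M : nat) (w : 'I_M -> inv_form) :=
  [/\ forall i, inv_val (w i) \in deg Om 1%N,
      forall i j, inv_ip (w i) (w j) = (i == j)%:R &
      forall x : inv_form, inv_val x \in deg Om 1%N ->
        lin_span (fun y => exists i, y = w i) x].
End InnerProduct.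

Definition degree_pred1 (T : Om -> Om) :=
  (forall x, x \in deg Om 0%N -> T x = 0) /\
  (forall k x, x \in deg Om k.+1 -> T x \in deg Om k).

Definition diff_coeffs (M : nat) (w : 'I_M -> inv_form) (chi : 'I_M -> {scalar A}) :=
  forall a : A,
    diff Om (emb Om a) = \sum_(r < M) emb Om (conv (chi r) a) * inv_val (w r).

End Invariants.

(* Main.v *)
(* Sweedler sums turn the Hopf-module arguments into calculations.  The       *)
(* projection P x = kappa(x_-1) x_0 takes values in the invariant forms: the  *)
(* defect D x = Delta(P x) - 1 \ox P x satisfies Delta(x_-1) D(x_0) = 0, and   *)
(* multiplying by Delta(kappa(x_-1)) on the left gives D x = 0.  As           *)
(* x = x_-1 P(x_0), the forms are A \ox Omega^inv, and the Leibniz rule gives *)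
(* the formula for d.  Since <a w, b e> = h(b^* a) <w, e>, its adjoint is     *)
(* computed factor by factor: the invariant forms are finite dimensional, and *)
(* the invariance of h identifies the adjoint of E_chi with E_{chi^*}.        *)

Require Import Defs.
From HB Require Import structures.
From mathcomp Require Import all_boot all_order all_algebra.
From mathcomp Require Import complex boolp reals.

Set Implicit Arguments.
Unset Strict Implicit.
Unset Printing Implicit Defensive.

Import Order.TTheory GRing.Theory Num.Theory.
Local Open Scope ring_scope.

(** A calculus postulates only a multiplicative coaction that extends the coproduct and commutes
    with [diff]. It is nevertheless counital and coassociative ([counit_coact], [coact_assoc]): both
    laws hold on [emb a], pass to [diff (emb a)], and survive products and linear combinations,
    which by [calculus_ind] reach every form. So the forms are a Hopf module, [inv_proj] retracts
    them onto the invariant forms, and [inv_decomp] inverts [inv_iso].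

    By [diff_coeffsP], expanding da with coefficients chi_r * a amounts to expanding the invariant
    form P(da) = kappa(a_1) d(a_2) with scalar coefficients chi_r(a). This gives existence and
    uniqueness of the functionals, and the Leibniz rule for a v turns it into the formula for d
    ([diff_inv_iso]).

    Left invariance factorizes the inner product on A \ox Omega^inv, so each tensor factor can be
    moved across separately. Operators on Omega^inv have adjoints by finite dimensionality
    ([frame_exists], [frame_adjointable]). On A, which may be infinite dimensional, E_chi is moved
    across by the invariance of h ([haar_conv]). [diff_adjoint] assembles these, definiteness makes
    the result the only adjoint, and orthogonality of the grading gives its degree
    ([adjoint_degree]). *)

Ltac by_linearity := rewrite /=;
  do ?[rewrite linearP /= | rewrite linearPl /= | rewrite linearPr /=
      | rewrite mulrDl | rewrite mulrDr | rewrite -scalerAl | rewrite -scalerAr];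
  by [].

(** * Calculus of Sweedler sums *)

Section Sweedler.
Variables (K : numClosedFieldType) (U V : lmodType K).

(* sw t F is F(t_1, t_2) in Sweedler notation t = t_1 \ox t_2; it depends on  *)
(* the chosen representative of t unless F is bilinear.                       *)
Definition sw {W : lmodType K} (t : U \ox V) (F : U -> V -> W) : W :=
  \sum_(p <- repr t) F p.1 p.2.

Lemma eq_sw (W : lmodType K) (t : U \ox V) (F G : U -> V -> W) :
  (forall u v, F u v = G u v) -> sw t F = sw t G.
Proof. by move=> FG; apply: eq_bigr. Qed.

Lemma sw_tens (t : U \ox V) : sw t (@pure_tens K U V) = t.
Proof. by rewrite {2}[t]tens_sum_repr. Qed.

Lemma raddf_sw (W W' : lmodType K) (g : {additive W -> W'}) t
    (F : U -> V -> W) :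
  g (sw t F) = sw t (fun u v => g (F u v)).
Proof. exact: raddf_sum. Qed.

Lemma linear_sw (W W' : lmodType K) (g : W -> W') t (F : U -> V -> W) :
  linear g -> g (sw t F) = sw t (fun u v => g (F u v)).
Proof.
move=> gL; pose g' : {linear W -> W'} :=
  HB.pack g (GRing.isLinear.Build K _ _ _ g gL).
exact: (raddf_sw g').
Qed.

Lemma swP (W : lmodType K) t k (F G : U -> V -> W) :
  sw t (fun u v => k *: F u v + G u v) = k *: sw t F + sw t G.
Proof. by rewrite /sw scaler_sumr -big_split. Qed.

Section Bilinear.
Variables (W : lmodType K) (F : U -> V -> W).
Hypothesis Fbil : bilinear_for *:%R *:%R F.

Let f : {bilinear U -> V -> W} :=
  HB.pack F (bilinear_isBilinear.Build K U V W _ _ F Fbil).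

(** For bilinear [F] the sum is by conversion [tens_lift] of the packed map, so it no longer depends
    on the representative. *)
Lemma sw_linear : linear (sw^~ F).
Proof. by move=> k s t; rewrite -[sw _ _]/(tens_lift f _) linearP. Qed.

Lemma sw_pure u v : sw (u \ox v) F = F u v.
Proof. exact: (tens_liftE f). Qed.

Lemma sw_sum (I : Type) (r : seq I) (x : I -> U) (y : I -> V) :
  sw (\sum_(i <- r) x i \ox y i) F = \sum_(i <- r) F (x i) (y i).
Proof.
rewrite -[sw _ _]/(tens_lift f _) linear_sum /=.
by apply: eq_bigr => i _; rewrite tens_liftE.
Qed.
End Bilinear.

Lemma linear_tens_ext (W : lmodType K) (f g : U \ox V -> W) :
  linear f -> linear g -> (forall u v, f (u \ox v) = g (u \ox v)) -> f =1 g.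
Proof.
move=> fL gL.
pose f' : {linear tens U V -> W} := HB.pack f (GRing.isLinear.Build K _ _ _ f fL).
pose g' : {linear tens U V -> W} := HB.pack g (GRing.isLinear.Build K _ _ _ g gL).
exact: (@tens_lift_uniq K U V W f' g').
Qed.
End Sweedler.

Lemma sw_map (K : numClosedFieldType) (U U' V V' W : lmodType K)
    (f : {linear U -> U'}) (g : {linear V -> V'}) (F : U' -> V' -> W) t :
  bilinear_for *:%R *:%R F ->
  sw (tens_map f g t) F = sw t (fun u v => F (f u) (g v)).
Proof.
move=> FB.
have FB' : bilinear_for *:%R *:%R (fun u v => F (f u) (g v)).
  by split=> [v|u] k x y; rewrite linearP FB.
move: t; apply: linear_tens_ext => [k x y|k x y|u v].
- by rewrite linearP sw_linear.
- by rewrite sw_linear.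
- by rewrite tens_mapE !sw_pure.
Qed.

Lemma sw_swap (K : numClosedFieldType) (U U' V V' W : lmodType K)
    (s : U \ox V) (t : U' \ox V') (F : U -> V -> U' -> V' -> W) :
  sw s (fun u v => sw t (F u v)) =
  sw t (fun u' v' => sw s (fun u v => F u v u' v')).
Proof. exact: exchange_big. Qed.

Section TripleTensor.
Variables (K : numClosedFieldType) (U V W X : lmodType K).

Definition trilinear (F : U -> V -> W -> X) :=
  [/\ forall v w, linear (fun u => F u v w),
      forall u w, linear (fun v => F u v w) & forall u v, linear (F u v)].

Variable F : U -> V -> W -> X.
Hypothesis F3 : trilinear F.

Lemma sw_trilinearl :
  bilinear_for *:%R *:%R (fun s c => sw s (fun a b => F a b c)).
Proof.
case: F3 => F1 F2 F3'; split=> [c|s] k x y; first by rewrite sw_linear.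
by rewrite -swP; apply: eq_sw => a b; rewrite F3'.
Qed.

Lemma sw_trilinearr : bilinear_for *:%R *:%R (fun a s => sw s (F a)).
Proof.
case: F3 => F1 F2 F3'; split=> [s|a] k x y; last by rewrite sw_linear.
by rewrite -swP; apply: eq_sw => b c; rewrite F1.
Qed.

Lemma sw_assoc (t : (U \ox V) \ox W) :
  sw (tens_assoc t) (fun a s => sw s (F a)) =
  sw t (fun s c => sw s (fun a b => F a b c)).
Proof.
have [F1 F2 F3'] := F3.
move: t; apply: linear_tens_ext => [k x y|k x y|s c].
- by rewrite linearP (sw_linear sw_trilinearr).
- by rewrite (sw_linear sw_trilinearl).
rewrite (sw_pure sw_trilinearl); move: s.
apply: linear_tens_ext => [k x y|k x y|a b].
- by rewrite linearPl linearP /= (sw_linear sw_trilinearr).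
- by rewrite sw_linear.
- by rewrite tens_assocE (sw_pure sw_trilinearr) !sw_pure.
Qed.
End TripleTensor.

(** * Hopf algebra identities in Sweedler form *)

Section Hopf.
Variables (C : numClosedFieldType) (A : hopfStarAlg C).

Section Coassociativity.
Variables (X : lmodType C) (F : A -> A -> A -> X).
Hypothesis F3 : trilinear F.

Lemma comul_assoc (a : A) :
  sw (comul a) (fun b c => sw (comul b) (fun d e => F d e c)) =
  sw (comul a) (fun b c => sw (comul c) (F b)).
Proof.
have := sw_assoc F3 (tens_map (comul) idfun (comul a)).
rewrite comulA (sw_map _ _ _ (sw_trilinearl F3)) /=.
by rewrite (sw_map _ _ _ (sw_trilinearr F3)).
Qed.
End Coassociativity.

Lemma counit_swl (a : A) : sw (comul a) (fun b c => counit b *: c) = a.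
Proof. exact: counitl. Qed.
Lemma counit_swr (a : A) : sw (comul a) (fun b c => counit c *: b) = a.
Proof. exact: counitr. Qed.
Lemma antipode_swl (a : A) :
  sw (comul a) (fun b c => antipode b * c) = (counit a)%:A.
Proof. exact: antipodel. Qed.
Lemma antipode_swr (a : A) :
  sw (comul a) (fun b c => b * antipode c) = (counit a)%:A.
Proof. exact: antipoder. Qed.

Lemma comul_star_sw (a : A) :
  comul (star a) = sw (comul a) (fun b c => star b \ox star c).
Proof. by apply: comul_star; rewrite -tens_sum_repr. Qed.

Lemma sw_comul_star (W : lmodType C) (a : A) (F : A -> A -> W) :
  bilinear_for *:%R *:%R F ->
  sw (comul (star a)) F = sw (comul a) (fun b c => F (star b) (star c)).
Proof. by move=> FB; rewrite comul_star_sw sw_sum. Qed.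

(** Uniqueness of the counit: the conjugate functional [e] is a left counit, [counit] is a right
    counit, and evaluating e(a_1) counit(a_2) in two ways identifies them. *)
Lemma counit_star (a : A) : counit (star a) = (counit a)^*.
Proof.
pose e (b : A) := (counit (star b))^*.
have eP b : sw (comul b) (fun c d => e c *: d) = b.
  apply: (can_inj (@starK C A)); rewrite -[RHS]counit_swl sw_comul_star; last first.
    exact: slicel_fun_is_bilinear.
  rewrite raddf_sw; apply: eq_sw => c d.
  by rewrite [LHS]linearZ_LR /= conjCK.
suff <- : e a = counit a by rewrite conjCK.
rewrite -{2}[a]eP -{1}[a]counit_swr /e /sw !raddf_sum.
apply: eq_bigr => p _ /=.
by rewrite [star _]linearZ_LR /= !linearZ_LR /= rmorphM /= conjCK mulrC.
Qed.
End Hopf.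

Lemma tens_scalerAl (K : numClosedFieldType) (A B : algType K) k (s t : A \ox B) :
  k *: (s * t) = (k *: s) * t.
Proof. by symmetry; apply: tens_mulZl. Qed.

Lemma tens_scalerAr (K : numClosedFieldType) (A B : algType K) k (s t : A \ox B) :
  k *: (s * t) = s * (k *: t).
Proof. by symmetry; apply: tens_mulZr. Qed.

Lemma sw_mul (K : numClosedFieldType) (A B : algType K) (W : lmodType K)
    (s t : A \ox B) (F : A -> B -> W) :
  bilinear_for *:%R *:%R F ->
  sw (s * t) F = sw s (fun a b => sw t (fun c d => F (a * c) (b * d))).
Proof.
move=> FB.
have FB1 a b : bilinear_for *:%R *:%R (fun c d => F (a * c) (b * d)).
  by split=> [u|u] k x y; rewrite mulrDr -scalerAr FB.
have FB2 : bilinear_for *:%R *:%R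
    (fun a b => sw t (fun c d => F (a * c) (b * d))).
  by split=> [u|u] k x y; rewrite -swP; apply: eq_sw => c d;
    rewrite mulrDl -scalerAl FB.
move: s; apply: linear_tens_ext => [k x y|k x y|a b].
- by rewrite mulrDl -tens_scalerAl sw_linear.
- by rewrite sw_linear.
rewrite sw_pure //; move: t {FB2}; apply: linear_tens_ext => [k x y|k x y|c d].
- by rewrite mulrDr -tens_scalerAr sw_linear.
- by rewrite sw_linear.
by rewrite pure_tensM !sw_pure.
Qed.

(** * The Hopf module of forms and its invariants *)

Section Comodule.
Variables (C : numClosedFieldType) (A : hopfStarAlg C) (Om : starCalculus A).

Lemma calculus_ind (P : Om -> Prop) :
  (forall k x y, P x -> P y -> P (k *: x + y)) ->
  (forall a, P (emb Om a)) ->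
  (forall x a, P x -> P (x * diff Om (emb Om a))) -> forall x, P x.
Proof.
move=> PL Pe Pd x.
have P0 : P 0 by have := Pe 0; rewrite raddf0.
have PD y z : P y -> P z -> P (y + z) by rewrite -{2}[y]scale1r => ? ?; apply: PL.
have [n [y [yk ->]]] := deg_sum x.
elim/big_ind: _ => // -[k _] /= _; case: k => [|k] in y yk *.
  by have /emb_deg0[a ->] := yk 0%N.
have /(@deg_span _ _ Om k.+1 _ isT)[m [c [v [vP ->]]]] := yk k.+1.
elim/big_ind: _ => // i _; rewrite -[_ *: _]addr0; apply: PL => //.
have [a [b ->]] := vP i; elim: k.+1 b => [|l IH] b.
  by rewrite big_ord0 mulr1.
by rewrite big_ord_recr /= mulrA; apply: Pd; apply: IH.
Qed.

Lemma sw_coact_emb (W : lmodType C) a (F : A -> Om -> W) :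
  bilinear_for *:%R *:%R F ->
  sw (coact Om (emb Om a)) F = sw (comul a) (fun b c => F b (emb Om c)).
Proof. by move=> FB; rewrite coact_emb sw_map. Qed.

Lemma sw_coact_diff (W : lmodType C) x (F : A -> Om -> W) :
  bilinear_for *:%R *:%R F ->
  sw (coact Om (diff Om x)) F = sw (coact Om x) (fun b y => F b (diff Om y)).
Proof. by move=> FB; rewrite -coact_diff sw_map. Qed.

Lemma sw_coactM (W : lmodType C) x y (F : A -> Om -> W) :
  bilinear_for *:%R *:%R F ->
  sw (coact Om (x * y)) F =
  sw (coact Om x) (fun a z => sw (coact Om y) (fun b t => F (a * b) (z * t))).
Proof. by move=> FB; rewrite rmorphM sw_mul. Qed.

Lemma counit_coact x : sw (coact Om x) (fun a y => counit a *: y) = x.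
Proof.
have B : bilinear_for *:%R *:%R (fun (a : A) (y : Om) => counit a *: y).
  exact: slicel_fun_is_bilinear.
have Be a : sw (coact Om (emb Om a)) (fun a y => counit a *: y) = emb Om a.
  rewrite sw_coact_emb // -{2}[a]counit_swl [RHS]raddf_sw.
  by apply: eq_sw => b c; rewrite [RHS]linearZ.
have Bd a : sw (coact Om (diff Om (emb Om a))) (fun a y => counit a *: y) =
    diff Om (emb Om a).
  rewrite sw_coact_diff // -{2}[emb Om a]Be [RHS]raddf_sw.
  by apply: eq_sw => b c; rewrite [RHS]linearZ.
elim/calculus_ind: x => [k x y Hx Hy|a|x a Hx]; last 1 first.
- rewrite sw_coactM // -{2}Hx -{2}[diff _ _]Bd /sw mulr_suml.
  apply: eq_bigr => p _; rewrite mulr_sumr; apply: eq_bigr => q _.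
  by rewrite rmorphM /= -scalerAr -scalerAl scalerA mulrC.
- by rewrite linearP sw_linear ?Hx ?Hy.
- exact: Be.
Qed.

Lemma coact_assoc (X : lmodType C) (F : A -> A -> Om -> X) x : trilinear F ->
  sw (coact Om x) (fun a y => sw (comul a) (fun b c => F b c y)) =
  sw (coact Om x) (fun a y => sw (coact Om y) (F a)).
Proof.
have linl (Y : lmodType C) (G : A -> A -> Om -> Y) : trilinear G ->
    bilinear_for *:%R *:%R (fun a y => sw (comul a) (fun b c => G b c y)).
  case=> G1 G2 G3; split=> [u|u] k y z; first by rewrite linearP sw_linear.
  by rewrite -swP; apply: eq_sw => b c; rewrite G3.
have linr (Y : lmodType C) (G : A -> A -> Om -> Y) : trilinear G ->
    bilinear_for *:%R *:%R (fun a y => sw (coact Om y) (G a)).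
  case=> G1 G2 G3; split=> [u|u] k y z; last by rewrite linearP sw_linear.
  by rewrite -swP; apply: eq_sw => b c; rewrite G1.
have Be (Y : lmodType C) (G : A -> A -> Om -> Y) a : trilinear G ->
  sw (coact Om (emb Om a)) (fun a y => sw (comul a) (fun b c => G b c y)) =
  sw (coact Om (emb Om a)) (fun a y => sw (coact Om y) (G a)).
  move=> G0; have [G1 G2 G3] := G0.
  rewrite !sw_coact_emb ?(comul_assoc (F := fun a b c => G a b (emb Om c)));
    [|by split=> u v k y z; rewrite ?linearP /= ?G1 ?G2 ?G3|exact: linr
    |exact: linl].
  by apply: eq_sw => b c; rewrite sw_coact_emb.
have Bd (Y : lmodType C) (G : A -> A -> Om -> Y) a : trilinear G ->
  sw (coact Om (diff Om (emb Om a)))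
    (fun a y => sw (comul a) (fun b c => G b c y)) =
  sw (coact Om (diff Om (emb Om a))) (fun a y => sw (coact Om y) (G a)).
  move=> G0; have [G1 G2 G3] := G0.
  rewrite sw_coact_diff ?(Be _ (fun a b y => G a b (diff Om y))); last exact: linl.
    rewrite sw_coact_diff; last exact: linr.
    by apply: eq_sw => b y; rewrite sw_coact_diff.
  by split=> u v k y z; rewrite ?linearP /= ?G1 ?G2 ?G3.
(* [F] is generalized because the product case applies the hypothesis on [x] to another trilinear
   map, in which the sum over the coaction of d(a) is absorbed; [Bd] then treats the factor d(a). *)
elim/calculus_ind: x X F => [k x y Hx Hy|a|x a Hx] X F F0.
- by rewrite linearP !sw_linear ?Hx ?Hy //; [exact: linr|exact: linl].
- exact: Be.
have [F1 F2 F3] := F0.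
rewrite !sw_coactM; [|exact: linr|exact: linl].
set d := diff Om _.
have G0 a1 a2 z : trilinear (fun b1 b2 t => F (a1 * b1) (a2 * b2) (z * t)).
  by split=> u v k y t; rewrite mulrDr -scalerAr ?F1 ?F2 ?F3.
transitivity (sw (coact Om x) (fun b z => sw (comul b) (fun a1 a2 =>
    sw (coact Om d) (fun b t => sw (comul b) (fun b1 b2 =>
      F (a1 * b1) (a2 * b2) (z * t)))))).
  apply: eq_sw => b z; rewrite sw_swap; apply: eq_sw => c t.
  by rewrite rmorphM sw_mul.
rewrite (Hx _ (fun a1 a2 z => sw (coact Om d) (fun b t => sw (comul b)
  (fun b1 b2 => F (a1 * b1) (a2 * b2) (z * t))))); last first.
  by split=> u v k y t; rewrite -swP; apply: eq_sw => b e; rewrite -swP;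
    apply: eq_sw => b1 b2; rewrite mulrDl -scalerAl ?F1 ?F2 ?F3.
apply: eq_sw => a1 z.
transitivity (sw (coact Om z) (fun a2 z => sw (coact Om d) (fun b1 t =>
    sw (coact Om t) (fun b2 t => F (a1 * b1) (a2 * b2) (z * t))))).
  by apply: eq_sw => a2 y; rewrite (Bd _ _ _ (G0 a1 a2 y)).
by rewrite sw_swap; apply: eq_sw => b t; rewrite sw_coactM.
Qed.

Definition inv_proj (x : Om) : Om :=
  sw (coact Om x) (fun a y => emb Om (antipode a) * y).

Lemma inv_proj_bilinear :
  bilinear_for *:%R *:%R (fun (a : A) (y : Om) => emb Om (antipode a) * y).
Proof.
by split=> [u|u] k x y; rewrite ?linearP ?mulrDl ?mulrDr -?scalerAl -?scalerAr.
Qed.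

Lemma inv_proj_linear : linear inv_proj.
Proof.
move=> k x y; rewrite /inv_proj linearP sw_linear //; exact: inv_proj_bilinear.
Qed.
HB.instance Definition _ :=
  GRing.isLinear.Build C Om Om *:%R inv_proj inv_proj_linear.

Lemma inv_proj_sum x : sw (coact Om x) (fun a y => emb Om a * inv_proj y) = x.
Proof.
transitivity (sw (coact Om x) (fun a y => sw (coact Om y)
    (fun b z => emb Om a * (emb Om (antipode b) * z)))).
  by apply: eq_sw => a y; rewrite /inv_proj /sw mulr_sumr.
rewrite -(coact_assoc (F := fun a b z => emb Om a * (emb Om (antipode b) * z))).
  rewrite -[RHS]counit_coact; apply: eq_sw => a y.
  transitivity (emb Om (sw (comul a) (fun b c => b * antipode c)) * y).
    rewrite raddf_sw /sw mulr_suml; apply: eq_bigr => p _.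
    by rewrite /= rmorphM mulrA.
  by rewrite antipode_swr linearZ /= rmorph1 -scalerAl mul1r.
by split=> u v k y z; rewrite ?linearP ?(mulrDl, mulrDr) -?(scalerAl, scalerAr);
  rewrite ?(mulrDl, mulrDr) -?(scalerAl, scalerAr).
Qed.

Lemma inv_proj_inv x : coact Om (inv_proj x) = 1 \ox inv_proj x.
Proof.
pose D y := coact Om (inv_proj y) - 1 \ox inv_proj y.
have DL : linear D.
  by move=> k y z; rewrite /D !linearP /= linearPr opprD addrACA scalerBr.
(* Both halves of [D] sum to [coact Om y]: the first by multiplicativity and y = y_-1 P(y_0), the
   second by coassociativity and the same identity applied to y_0. *)
have Z y : sw (coact Om y) (fun a z => coact Om (emb Om a) * D z) = 0.
  transitivity (sw (coact Om y) (fun a z => coact Om (emb Om a * inv_proj z)) -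
      sw (coact Om y) (fun a z => coact Om (emb Om a) * (1 \ox inv_proj z))).
    rewrite /sw -sumrB; apply: eq_bigr => p _.
    by rewrite rmorphM -mulrBr.
  rewrite -(raddf_sw (coact Om)) inv_proj_sum; apply/eqP.
  rewrite subr_eq0; apply/eqP; symmetry.
  transitivity (sw (coact Om y) (fun a z => sw (comul a) (fun b c =>
      b \ox (emb Om c * inv_proj z)))).
    apply: eq_sw => a z; rewrite coact_emb -{1}[comul a]sw_tens raddf_sw.
    rewrite /sw mulr_suml; apply: eq_bigr => p _ /=.
    by rewrite tens_mapE pure_tensM mulr1.
  rewrite (coact_assoc (F := fun a b z => a \ox (emb Om b * inv_proj z))).
    rewrite -[RHS]sw_tens; apply: eq_sw => a z.
    rewrite -{2}[z]inv_proj_sum.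
    by rewrite (linear_sw (g := pure_tens a)) // => k u v; rewrite linearPr.
  split=> u v k s t; rewrite ?linearP ?mulrDl ?mulrDr -?scalerAl -?scalerAr;
  by rewrite ?(linearPl, linearPr).
apply/eqP; rewrite -subr_eq0 -/(D x); apply/eqP; clearbody D.
have -> : D x = sw (coact Om x) (fun a y => counit a *: D y).
  rewrite -{1}[x]counit_coact (linear_sw _ _ DL); apply: eq_sw => a y.
  have := DL (counit a) y 0; rewrite addr0 => ->.
  by have := DL (-1) 0 0; rewrite scaler0 addr0 scaleN1r addNr => ->; rewrite addr0.
(* The scalar counit(a) is rewritten as kappa(a_1) a_2 under the coaction; coassociativity then
   exposes the vanishing sum [Z] behind the factor from kappa. *)
transitivity (sw (coact Om x) (fun a y => sw (comul a) (fun b c =>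
    coact Om (emb Om (antipode b)) * (coact Om (emb Om c) * D y)))).
  apply: eq_sw => a y.
  transitivity (coact Om (emb Om (sw (comul a) (fun b c => antipode b * c))) * D y).
    rewrite antipode_swl !linearZ /= !rmorph1 -tens_scalerAl.
    by congr (_ *: _); rewrite -[LHS]mul1r.
  rewrite raddf_sw /sw raddf_sum mulr_suml; apply: eq_bigr => p _ /=.
  by rewrite !rmorphM mulrA.
rewrite (coact_assoc (F := fun a b y =>
    coact Om (emb Om (antipode a)) * (coact Om (emb Om b) * D y))).
  rewrite /sw big1 // => p _; rewrite -mulr_sumr.
  by have := Z p.2; rewrite /sw => ->; rewrite mulr0.
split=> u v k s t; rewrite ?DL; do ?rewrite linearP /=; rewrite ?(mulrDl, mulrDr).
- by rewrite -tens_scalerAl.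
- by rewrite -tens_scalerAl -tens_scalerAr.
- by rewrite -!tens_scalerAr.
Qed.

(** The invariant factor contributes only 1 \ox v to the coaction, leaving kappa(a_1) a_2 v. *)
Lemma inv_proj_emb a (v : inv_form Om) :
  inv_proj (emb Om a * inv_val v) = counit a *: inv_val v.
Proof.
rewrite /inv_proj sw_coactM; last exact: inv_proj_bilinear.
transitivity (sw (coact Om (emb Om a)) (fun b y =>
    emb Om (antipode b) * y * inv_val v)).
  apply: eq_sw => b y; rewrite inv_valP sw_pure ?mulr1 ?mulrA //.
  by split=> [u|u] k s t; by_linearity.
rewrite sw_coact_emb; last first.
  by split=> [u|u] k s t; by_linearity.
transitivity (emb Om (sw (comul a) (fun b c => antipode b * c)) * inv_val v).
  rewrite raddf_sw /sw mulr_suml; apply: eq_bigr => p _ /=.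
  by rewrite rmorphM.
by rewrite antipode_swl linearZ /= rmorph1 -scalerAl mul1r.
Qed.

Lemma inv_proj_subproof x : inv_proj x \in inv_pred (Om := Om).
Proof. exact/inv_predP/inv_proj_inv. Qed.

Definition inv_part (x : Om) : inv_form Om := Inv (inv_proj_subproof x).

Lemma inv_part_linear : linear inv_part.
Proof. by move=> k x y; apply: val_inj; rewrite /= linearP. Qed.
HB.instance Definition _ :=
  GRing.isLinear.Build C Om (inv_form Om) *:%R inv_part inv_part_linear.

Lemma inv_part_emb a (v : inv_form Om) :
  inv_part (emb Om a * inv_val v) = counit a *: v.
Proof. by apply: val_inj; rewrite /= inv_proj_emb. Qed.

(** The identity x = x_-1 P(x_0), read as a tensor: the inverse of [inv_iso]. *)
Definition inv_decomp (x : Om) : A \ox inv_form Om :=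
  sw (coact Om x) (fun a y => a \ox inv_part y).

Lemma inv_decomp_bilinear :
  bilinear_for *:%R *:%R (fun (a : A) (y : Om) => a \ox inv_part y).
Proof. by split=> [u|u] k x y; by_linearity. Qed.

Lemma inv_decomp_linear : linear inv_decomp.
Proof.
move=> k x y; rewrite /inv_decomp linearP sw_linear //.
exact: inv_decomp_bilinear.
Qed.
HB.instance Definition _ :=
  GRing.isLinear.Build C Om (tens A (inv_form Om)) *:%R inv_decomp inv_decomp_linear.

Lemma inv_isoE a (v : inv_form Om) : inv_iso (a \ox v) = emb Om a * inv_val v.
Proof. exact: tens_prodE. Qed.

Lemma inv_decompK : cancel inv_decomp (inv_iso (Om := Om)).
Proof.
move=> x; rewrite -[RHS]inv_proj_sum /inv_decomp raddf_sw.
by apply: eq_sw => a y; rewrite /= inv_isoE.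
Qed.

Lemma inv_isoK : cancel (inv_iso (Om := Om)) inv_decomp.
Proof.
apply: linear_tens_ext => [k x y|k x y|a v]; rewrite ?linearP //.
rewrite inv_isoE /inv_decomp sw_coactM; last exact: inv_decomp_bilinear.
transitivity (sw (coact Om (emb Om a)) (fun b y =>
    b \ox inv_part (y * inv_val v))).
  apply: eq_sw => b y; rewrite inv_valP sw_pure ?mulr1 //.
  by split=> [u|u] k s t; by_linearity.
rewrite sw_coact_emb; last first.
  by split=> [u|u] k s t; by_linearity.
transitivity (sw (comul a) (fun b c => counit c *: b) \ox v); last first.
  by rewrite counit_swr.
rewrite (linear_sw (g := fun b => b \ox v)); last by move=> k s t; rewrite linearPl.
apply: eq_sw => b c; rewrite inv_part_emb.
by rewrite linearZl_LR linearZr_LR.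
Qed.
End Comodule.

(** * Convolution operators and the Haar integral *)

(** This is the star of the antipode law at [star a]. With k' = star kappa star it permits the
    expansion h(b a_1) a_2 = h(b_1 a_1) k'(b_3) b_2 a_2, where invariance of h collapses the product
    b_1 a to a scalar. *)
Lemma inv_antipodel (C : numClosedFieldType) (A : hopfStarAlg C) (a : A) :
  sw (comul a) (fun b c => star (antipode (star c)) * b) = (counit a)%:A.
Proof.
apply: (can_inj (@starK C A)).
rewrite [RHS]linearZ_LR /= -counit_star.
have -> : star 1 = 1 :> A.
  by rewrite -[LHS]mul1r -{1}[1]starK -starM mul1r starK.
rewrite -antipode_swr sw_comul_star; last by split=> [u|u] k x y; by_linearity.
by rewrite raddf_sw; apply: eq_sw => b c /=; rewrite starM starK.
Qed.

(* The antipode of the opposite comultiplication, a |-> (antipode a^* )^*,    *)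
(* moves the comultiplication from one factor of h (b * a) to the other.      *)
Lemma haar_comul (C : numClosedFieldType) (A : hopfStarAlg C) (h : {scalar A})
    (a b : A) : is_haar h ->
  sw (comul a) (fun a1 a2 => h (b * a1) *: a2) =
  sw (comul b) (fun b1 b2 => h (b1 * a) *: star (antipode (star b2))).
Proof.
move=> hH; pose k' (x : A) := star (antipode (star x)).
have k'L : linear k'.
  by move=> c x y; rewrite /k'; do 3!rewrite linearP /=; rewrite conjCK.
pose F b1 b2 b3 := sw (comul a) (fun a1 a2 => h (b1 * a1) *: (k' b3 * (b2 * a2))).
have F3 : trilinear F.
  split=> u v c x y; rewrite /F -swP; apply: eq_sw => a1 a2.
  - by rewrite mulrDl -scalerAl linearP /= scalerDl scalerA.
  - by rewrite mulrDl -scalerAl mulrDr -scalerAr scalerDr !scalerA mulrC.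
  - by rewrite k'L mulrDl -scalerAl scalerDr !scalerA mulrC.
transitivity (sw (comul b) (fun b1 c => sw (comul c) (F b1))).
  rewrite -{1}[b]counit_swr.
  transitivity (sw (comul b) (fun b1 c => sw (comul a)
    (fun a1 a2 => h (b1 * a1) *: ((counit c)%:A * a2)))).
    rewrite sw_swap; apply: eq_sw => a1 a2.
    rewrite /sw mulr_suml raddf_sum scaler_suml; apply: eq_bigr => p _ /=.
    by rewrite -!scalerAl mul1r scalerA linearZ_LR /= mulrC.
  apply: eq_sw => b1 c; rewrite sw_swap; apply: eq_sw => a1 a2.
  rewrite -inv_antipodel /sw mulr_suml scaler_sumr; apply: eq_bigr => p _.
  by rewrite mulrA.
rewrite -comul_assoc //; apply: eq_sw => b1 b2.
transitivity (k' b2 * sw (comul (b1 * a)) (fun x y => h x *: y)).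
  rewrite rmorphM sw_mul; last exact: slicel_fun_is_bilinear.
  rewrite /F /sw mulr_sumr; apply: eq_bigr => p _; rewrite mulr_sumr.
  by apply: eq_bigr => q _; rewrite scalerAr.
have -> : sw (comul (b1 * a)) (fun x y => h x *: y) = (h (b1 * a))%:A.
  exact: haar_invl.
by rewrite -scalerAr mulr1.
Qed.

(** Apply chi to [haar_comul] at [star b]: the two stars around b_2 cancel, and chi(star (kappa
    b_2)) is the conjugate of [functional_star chi] at b_2. *)
Lemma haar_conv (C : numClosedFieldType) (A : hopfStarAlg C)
    (h chi : {scalar A}) (a b : A) : is_haar h ->
  h (star b * conv chi a) = h (star (conv (functional_star chi) b) * a).
Proof.
move=> hH.
transitivity (chi (sw (comul a) (fun a1 a2 => h (star b * a1) *: a2))).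
  rewrite /conv -[slicer _ _]/(sw _ _) /sw mulr_sumr !raddf_sum.
  by apply: eq_bigr => p _ /=; rewrite -scalerAr !linearZ_LR /= mulrC.
rewrite haar_comul // sw_comul_star; last first.
  split=> [u|u] k x y; first by rewrite mulrDl -scalerAl linearP /= scalerDl scalerA.
  do 3!rewrite linearP /=.
  by rewrite conjCK scalerDr !scalerA mulrC.
rewrite /conv -[slicer _ _]/(sw _ _) /sw !raddf_sum mulr_suml raddf_sum.
apply: eq_bigr => p _ /=; rewrite starK [star (_ *: _)]linearZ_LR /= -scalerAl.
by rewrite !linearZ_LR /= /functional_star conjCK mulrC.
Qed.

(** * Inner product spaces, frames and adjoints *)

Section InnerProduct.
Variables (C : numClosedFieldType) (X : lmodType C) (ip : X -> X -> C).

Definition inner_product :=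
  [/\ forall y, scalar (ip^~ y), forall x y, ip x y = (ip y x)^* &
      forall x, x != 0 -> 0 < ip x x].

Hypothesis ipP : inner_product.

Let ipl (y : X) : {scalar X} :=
  let: And3 ipL _ _ := ipP in
  HB.pack_for {scalar X} (ip^~ y) (GRing.isLinear.Build C X C *%R _ (ipL y)).

Lemma ip_conj x y : ip x y = (ip y x)^*.
Proof. by case: ipP. Qed.

Lemma ipZl k x y : ip (k *: x) y = k * ip x y.
Proof. by have := linearZ_LR (ipl y) k x; rewrite /ipl; case: ipP. Qed.

Lemma ipDl x x' y : ip (x + x') y = ip x y + ip x' y.
Proof. by have := linearD (ipl y) x x'; rewrite /ipl; case: ipP. Qed.

Lemma ip_suml (I : Type) (r : seq I) (v : I -> X) y :
  ip (\sum_(i <- r) v i) y = \sum_(i <- r) ip (v i) y.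
Proof. by have := linear_sum (ipl y) r xpredT v; rewrite /ipl; case: ipP. Qed.

Lemma ipZr k x y : ip x (k *: y) = k^* * ip x y.
Proof. by rewrite ip_conj ipZl rmorphM /= -ip_conj. Qed.

Lemma ipDr x y y' : ip x (y + y') = ip x y + ip x y'.
Proof. by rewrite ip_conj ipDl rmorphD /= -!ip_conj. Qed.

Lemma ip_sumr (I : Type) (r : seq I) (v : I -> X) x :
  ip x (\sum_(i <- r) v i) = \sum_(i <- r) ip x (v i).
Proof.
by rewrite ip_conj ip_suml rmorph_sum; apply: eq_bigr => i _; rewrite /= -ip_conj.
Qed.

Lemma ip_eq0 x : ip x x = 0 -> x = 0.
Proof.
have [_ _ ip0] := ipP; move=> xx; apply/eqP/negPn/negP => /ip0.
by rewrite xx ltxx.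
Qed.

Lemma ip_nondeg x y : (forall z, ip z x = ip z y) -> x = y.
Proof.
move=> xy; apply/eqP; rewrite -subr_eq0 -scaleN1r; apply/eqP/ip_eq0.
by rewrite ipDr ipZr rmorphN1 xy mulN1r subrr.
Qed.

Lemma is_adjoint_uniq T (S S' : X -> X) :
  is_adjoint ip T S -> is_adjoint ip T S' -> S =1 S'.
Proof. by move=> TS TS' y; apply: ip_nondeg => x; rewrite -TS TS'. Qed.

(** The reconstruction identity of a Parseval frame, the form in which finite dimensionality
    enters. *)
Definition frame M (w : 'I_M -> X) :=
  forall x, x = \sum_(i < M) ip x (w i) *: w i.

(** Expanding x in the frame gives ip (T x) y as the sum of ip x (w i) * ip (T (w i)) y, which
    dictates the witness [S]. *)
Lemma frame_adjointable M (w : 'I_M -> X) (T : {linear X -> X}) :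
  frame w -> adjointable ip T.
Proof.
move=> wP; pose S y := \sum_(i < M) ip y (T (w i)) *: w i.
have [ipL _ ip0] := ipP.
have SL : linear S.
  move=> k x y; rewrite /S scaler_sumr -big_split; apply: eq_bigr => i _.
  by rewrite ipL scalerDl scalerA.
pose S' : {linear X -> X} := HB.pack S (GRing.isLinear.Build C X X *:%R S SL).
exists S' => x y; rewrite -[S' y]/(S y).
rewrite ip_sumr {1}[x]wP linear_sum ip_suml; apply: eq_bigr => i _.
by rewrite linearZ ipZl ipZr mulrC -ip_conj.
Qed.

Lemma frame_exists (s : seq X) :
  (forall x, lin_span (fun y => y \in s) x) ->
  exists M (w : 'I_M -> X), frame w.
Proof.
have [ipL _ ip0] := ipP; move=> sP.
pose P e x := \sum_(v <- e) ip x v *: v.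
have PL e : linear (P e).
  move=> k x y; rewrite /P scaler_sumr -big_split; apply: eq_bigr => i _.
  by rewrite ipL scalerDl scalerA.
pose PP e : {linear X -> X} :=
  HB.pack (P e) (GRing.isLinear.Build C X X *:%R _ (PL e)).
have Psym e x y : ip (P e x) y = ip x (P e y).
  rewrite ip_suml ip_sumr; apply: eq_bigr => v _.
  by rewrite ipZl ipZr mulrC -ip_conj.
(* Gram-Schmidt by induction on [s]. The invariant says only that [P e] fixes [s] and [e]; fixing
   [e] already makes [P e] idempotent. *)
suff [e eP] : exists e, {in s ++ e, forall x, P e x = x}.
  exists (size e), (tnth (in_tuple e)) => x.
  rewrite -(big_tnth _ _ e xpredT (fun v => ip x v *: v)) -/(P e x).
  have [n [c [v [vs ->]]]] := sP x.
  rewrite -[RHS]/(PP e _) linear_sum; apply: eq_bigr => i _.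
  by rewrite linearZ /= eP // mem_cat vs.
elim: s {sP} => [|u s [e eP]]; first by exists [::].
have PK x : P e (P e x) = P e x.
  transitivity (PP e (\sum_(v <- e) ip x v *: v)) => //.
  rewrite linear_sum [RHS]/P !big_seq; apply: eq_bigr => v ve.
  by rewrite linearZ /= eP // mem_cat ve orbT.
have [u0|u0] := eqVneq (u - P e u) 0.
  exists e => x; rewrite inE => /orP[/eqP->|]; last exact: eP.
  by apply/esym/eqP; rewrite -subr_eq0 u0.
pose n := sqrtC (ip (u - P e u) (u - P e u)).
have n0 : 0 < n by rewrite sqrtC_gt0 ip0.
pose w := n^-1 *: (u - P e u).
have ww : ip w w = 1.
  rewrite ipZl ipZr geC0_conj ?invr_ge0 ?ltW // mulrA -expr2 exprVn sqrtCK.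
  by rewrite mulVf // gt_eqF // ip0.
have uP : u = P e u + n *: w.
  by rewrite scalerA divff ?gt_eqF // scale1r addrC subrK.
(* The idempotent [P e] kills [w] and is symmetric, so the vectors it fixes are orthogonal to [w]
   and remain fixed once [w] is added. *)
have Pw : P e w = 0.
  by rewrite -[LHS]/(PP e _) linearZ linearB /= PK subrr scaler0.
have ipw x : ip (P e x) w = 0.
  by rewrite Psym Pw -(scale0r (0 : X)) ipZr rmorph0 mul0r.
have PwE x : P (w :: e) x = ip x w *: w + P e x by rewrite /P big_cons.
have PwP x : P e x = x -> P (w :: e) x = x.
  by move=> ex; rewrite PwE -{1}ex ipw scale0r add0r.
have Pww : P (w :: e) w = w by rewrite PwE ww Pw scale1r addr0.
exists (w :: e) => x; rewrite inE mem_cat inE => /or4P[/eqP->|xs|/eqP->|xe] //.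
- rewrite [in RHS]uP [in LHS]uP -[LHS]/(PP (w :: e) _) linearD linearZ /=.
  by rewrite Pww PwP.
- by apply: PwP; rewrite eP // mem_cat xs.
- by apply: PwP; rewrite eP // mem_cat xe orbT.
Qed.
End InnerProduct.

Lemma orthonormal_expansion (C : numClosedFieldType) (X : lmodType C)
    (ip : X -> X -> C) M (w : 'I_M -> X) x :
  inner_product ip ->
  (forall i j, ip (w i) (w j) = (i == j)%:R) ->
  lin_span (fun y => exists i, y = w i) x ->
  x = \sum_(i < M) ip x (w i) *: w i.
Proof.
move=> ipP wO [n [c [v [vw ->]]]].
under [RHS]eq_bigr do rewrite ip_suml // scaler_suml.
rewrite exchange_big; apply: eq_bigr => k _ /=; have [i ->] := vw k.
rewrite (bigD1 i) //= big1 => [|j /negPf ij]; rewrite ipZl // wO.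
  by rewrite eqxx mulr1 addr0.
by rewrite eq_sym ij mulr0 scale0r.
Qed.

Lemma dot_inner_product (C : numClosedFieldType) (X : lmodType C)
    (ip : {dot X for Num.conj}) : inner_product ip.
Proof.
split=> [y|x y|x x0]; last exact: neq0_dnorm_gt0.
  by move=> k x z; rewrite linearPl.
by rewrite hermC expr0 mul1r.
Qed.

Lemma inv_ip_inner_product (C : numClosedFieldType) (A : hopfStarAlg C)
    (Om : starCalculus A) (ip : {dot Om for Num.conj}) :
  inner_product (inv_ip ip).
Proof.
have [ipL ipC ip0] := dot_inner_product ip.
split=> [y|x y|x x0]; rewrite /inv_ip.
- by move=> k x z; rewrite linearP /= ipL.
- exact: ipC.
- apply: ip0; apply: contra x0 => /eqP x0; apply/eqP/val_inj.
  exact: etrans x0 (esym (linear0 (inv_val (Om := Om)))).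
Qed.

(** * The differential and its adjoint on A \ox Omega^inv *)

Section TensorOperator.
Variables (K : numClosedFieldType) (U V : lmodType K) (M : nat).
Variables (f : {linear V -> V}) (e : 'I_M -> {linear U -> U}).
Variables (m : 'I_M -> {linear V -> V}).

(** The common shape of d and of its adjoint. *)
Definition tens_op (t : U \ox V) : U \ox V :=
  tens_map idfun f t + \sum_(j < M) tens_map (e j) (m j) t.

Lemma tens_op_linear : linear tens_op.
Proof.
move=> k x y; rewrite /tens_op linearP scalerDr addrACA; congr (_ + _).
by rewrite scaler_sumr -big_split; apply: eq_bigr => j _; rewrite linearP.
Qed.
HB.instance Definition _ :=
  GRing.isLinear.Build K (tens U V) (tens U V) *:%R tens_op tens_op_linear.

Lemma tens_opE u v :
  tens_op (u \ox v) = u \ox f v + \sum_(j < M) e j u \ox m j v.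
Proof.
rewrite /tens_op tens_mapE; congr (_ + _); apply: eq_bigr => j _.
by rewrite tens_mapE.
Qed.
End TensorOperator.

Section Differential.
Variables (C : numClosedFieldType) (A : hopfStarAlg C) (Om : starCalculus A).

Lemma emb_in_deg0 a : emb Om a \in deg Om 0%N.
Proof. by apply/emb_deg0; exists a. Qed.

Lemma deg_sumr k (I : Type) (r : seq I) (x : I -> Om) :
  (forall i, x i \in deg Om k) -> \sum_(i <- r) x i \in deg Om k.
Proof.
have [d0 dL] := deg_submod Om k; move=> xk; elim/big_ind: _ => // y z yk zk.
by rewrite -[y]scale1r dL.
Qed.

Lemma diff_inv_deg1 a : inv_val (inv_part (diff Om (emb Om a))) \in deg Om 1%N.
Proof.
rewrite /= /inv_proj sw_coact_diff; last exact: inv_proj_bilinear.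
rewrite sw_coact_emb; last by split=> [u|u] k x y; by_linearity.
apply: deg_sumr => p; rewrite -[1%N]add0n degM ?emb_in_deg0 //.
exact/deg_diff/emb_in_deg0.
Qed.

Section Coefficients.
Variables (M : nat) (w : 'I_M -> inv_form Om).

(** Applying P replaces chi_r * a by its counit chi_r(a); conversely da = a_1 P(d a_2) restores the
    convolutions. *)
Lemma diff_coeffsP (chi : 'I_M -> {scalar A}) :
  diff_coeffs w chi <->
  forall a, inv_part (diff Om (emb Om a)) = \sum_(r < M) chi r a *: w r.
Proof.
split=> wchi a.
  rewrite wchi linear_sum; apply: eq_bigr => r _; rewrite /= inv_part_emb.
  congr (_ *: _); rewrite -{2}[a]counit_swl /conv -[slicer _ _]/(sw _ _) /sw.
  by rewrite !raddf_sum; apply: eq_bigr => p _ /=; rewrite !linearZ_LR /= mulrC.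
rewrite -[LHS]inv_proj_sum sw_coact_diff; last first.
  by split=> [u|u] k x y; by_linearity.
rewrite sw_coact_emb; last by split=> [u|u] k x y; by_linearity.
rewrite /sw.
under eq_bigr do
  rewrite -[inv_proj _]/(inv_val (inv_part _)) wchi linear_sum mulr_sumr.
rewrite exchange_big; apply: eq_bigr => r _ /=.
rewrite /conv -[slicer _ _]/(sw _ _) /sw raddf_sum mulr_suml.
by apply: eq_bigr => p _ /=; rewrite !linearZ_LR /= -scalerAl -scalerAr.
Qed.

Lemma diff_inv_iso (chi : 'I_M -> {scalar A}) : diff_coeffs w chi -> forall t,
  diff Om (inv_iso t) =
  inv_iso (tens_op (inv_diff (Om := Om)) (fun j => conv (chi j))
             (fun j => inv_mul (w j)) t).
Proof.
move=> wchi; apply: linear_tens_ext => [k x y|k x y|a v]; rewrite ?linearP //.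
rewrite tens_opE inv_isoE (diffM _ (emb_in_deg0 a)).
rewrite (linearD (inv_iso (Om := Om))) /= inv_isoE.
rewrite expr0 mul1r addrC wchi mulr_suml; congr (_ + _).
rewrite raddf_sum.
by apply: eq_bigr => j _; rewrite /= inv_isoE mulrA.
Qed.
End Coefficients.

Section Adjoint.
Variables (h : {scalar A}) (ip : {dot Om for Num.conj}).
Hypotheses (hH : is_haar h) (ip_left : left_invariant_ip ip h).
Let ipP := dot_inner_product ip.
Let inv_ipP := inv_ip_inner_product ip.

Lemma ip_tens_ext (U V : lmodType C) (f g f' g' : {linear tens U V -> Om}) :
  (forall u v u' v', ip (f (u \ox v)) (g (u' \ox v')) =
                     ip (f' (u \ox v)) (g' (u' \ox v'))) ->
  forall s t, ip (f s) (g t) = ip (f' s) (g' t).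
Proof.
move=> fg s t; elim/tens_ind: s => [|s s' Hs Hs'|u v].
- by rewrite !linear0 !linear0l.
- by rewrite !linearD !ipDl // Hs Hs'.
elim/tens_ind: t => [|t t' Ht Ht'|u' v'] //.
- by rewrite !linear0 ?linear0r.
- by rewrite !linearD /= Ht Ht'.
Qed.

(** On pure tensors the inner product is a product of an A-part and an invariant part: [haar_conv]
    handles the first, [DP] and [mP] the second. *)
Lemma diff_adjoint M (w : 'I_M -> inv_form Om) (chi : 'I_M -> {scalar A})
    (D : {linear inv_form Om -> inv_form Om})
    (m : 'I_M -> {linear inv_form Om -> inv_form Om}) :
  diff_coeffs w chi ->
  is_adjoint (inv_ip ip) (inv_diff (Om := Om)) D ->
  (forall j, is_adjoint (inv_ip ip) (inv_mul (w j)) (m j)) ->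
  is_adjoint ip (diff Om)
    (fun y => inv_iso (tens_op D (fun j => conv (functional_star (chi j))) m
                         (inv_decomp y))).
Proof.
move=> wchi DP mP x y; rewrite -[x]inv_decompK -{1}[y]inv_decompK.
move: (inv_decomp x) (inv_decomp y) => s t; rewrite (diff_inv_iso wchi).
apply: (ip_tens_ext
  (f := inv_iso (Om := Om) \o tens_op _ (fun j => conv (chi j)) _)
  (g := inv_iso (Om := Om)) (f' := inv_iso (Om := Om))
  (g' := inv_iso (Om := Om) \o tens_op _ _ _)) => a v b u /=.
rewrite !tens_opE !(linearD (inv_iso (Om := Om))) /= !inv_isoE ipDl // ipDr //.
rewrite !(linear_sum (inv_iso (Om := Om))) /= ip_suml // ip_sumr //.
congr (_ + _).
  rewrite -[diff _ _]/(inv_val (inv_diff v)) !ip_left.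
  by congr (_ * _); apply: DP.
apply: eq_bigr => j _; rewrite !inv_isoE !ip_left haar_conv //.
by congr (_ * _); apply: mP.
Qed.

(** A component y_i of x with i different from k satisfies ip y_i y_i = ip y_i x = 0. *)
Lemma deg_orthogonal k x : graded_ip ip ->
  (forall l y, l != k -> y \in deg Om l -> ip y x = 0) -> x \in deg Om k.
Proof.
move=> ipG xk; have [n [y [yk xE]]] := deg_sum x.
have y0 (i : 'I_n) : i != k :> nat -> y i = 0.
  move=> ik; apply: (ip_eq0 ipP); rewrite -[RHS](xk _ _ ik (yk i)) xE ip_sumr //.
  rewrite (bigD1 i) //= big1 ?addr0 // => j ji.
  by apply: (ipG i j); rewrite // eq_sym.
rewrite xE; apply: deg_sumr => i.
have [<-|/y0->] := eqVneq (i : nat) k; first exact: yk.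
by case: (deg_submod Om k).
Qed.

(** For x of degree k and y of degree l, ip y (S x) = ip (d y) x vanishes unless l + 1 = k; for k =
    0 this never happens, so S x = 0. *)
Lemma adjoint_degree (S : Om -> Om) : graded_ip ip ->
  is_adjoint ip (diff Om) S -> degree_pred1 S.
Proof.
move=> ipG SP; have S0 k l x y : x \in deg Om k -> y \in deg Om l -> l.+1 != k ->
    ip y (S x) = 0.
  by move=> xk yl lk; rewrite -SP (ipG l.+1 k) // deg_diff.
split=> [x x0|k x xk]; last first.
  by apply: deg_orthogonal => // l y lk yl; apply: S0 xk yl _.
apply: (ip_nondeg ipP) => z; have [n [y [yk ->]]] := deg_sum z.
rewrite !ip_suml //; apply: eq_bigr => i _; rewrite (S0 0%N i) //.
by rewrite linear0r.
Qed.

(** Stated through the reconstruction of the forms P(da) alone, so that it serves both a frame of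
    Omega^inv and an orthonormal basis of its degree-one part. *)
Lemma coeffs_exist M (w : 'I_M -> inv_form Om) :
  (forall a, let v := inv_part (diff Om (emb Om a)) in
     v = \sum_(r < M) inv_ip ip v (w r) *: w r) ->
  exists2 chi : 'I_M -> {scalar A}, diff_coeffs w chi &
    forall r a, chi r a = inv_ip ip (inv_part (diff Om (emb Om a))) (w r).
Proof.
move=> wE; pose c r a := inv_ip ip (inv_part (diff Om (emb Om a))) (w r).
have cL r : scalar (c r).
  move=> k a b; rewrite /c; do 3!rewrite linearP /=.
  by rewrite ipDl ?ipZl.
pose chi r : {scalar A} := HB.pack (c r) (GRing.isLinear.Build C A C *%R _ (cL r)).
by exists chi => //; apply/diff_coeffsP => a; apply: wE.
Qed.
End Adjoint.
End Differential.

Theorem theorem2p4 (R : realType) (A : hopfStarAlg R[i]) (h : {scalar A})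
    (Om : starCalculus A) (ip : {dot Om for Num.conj}) :
  is_haar h ->
  strongly_fd Om ->
  graded_ip ip ->
  left_invariant_ip ip h ->
  [/\ adjointable ip (diff Om),
      degree_pred1 (adjoint ip (diff Om)) &
      forall (M : nat) (w : 'I_M -> inv_form Om),
        inv1_orthonormal_basis ip w ->
        exists chi : 'I_M -> {scalar A},
          [/\ diff_coeffs w chi,
              (forall chi' : 'I_M -> {scalar A},
                 diff_coeffs w chi' -> forall r, chi' r =1 chi r),
              bijective (inv_iso (Om := Om)),
              (forall t : A \ox inv_form Om,
                 diff Om (inv_iso t) =
                 inv_iso (tens_map idfun (inv_diff (Om := Om)) t +
                          \sum_(j < M)
                            tens_map (conv (chi j)) (inv_mul (w j)) t)) &
              [/\ adjointable (inv_ip ip) (inv_diff (Om := Om)),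
                  forall j, adjointable (inv_ip ip) (inv_mul (w j)) &
                  forall t : A \ox inv_form Om,
                    adjoint ip (diff Om) (inv_iso t) =
                    inv_iso
                      (tens_map idfun
                         (adjoint (inv_ip ip) (inv_diff (Om := Om))) t +
                       \sum_(j < M)
                         tens_map (conv (functional_star (chi j)))
                           (adjoint (inv_ip ip) (inv_mul (w j))) t)]]].
Proof.
move=> hH [s sP] ipG ipL.
have ipP := dot_inner_product ip; have inv_ipP := inv_ip_inner_product ip.
have [N [e eP]] := frame_exists inv_ipP sP.
have adj (T : {linear inv_form Om -> inv_form Om}) : adjointable (inv_ip ip) T.
  exact: frame_adjointable eP.
have dA M (w : 'I_M -> inv_form Om) (chi : 'I_M -> {scalar A}) :
    diff_coeffs w chi -> is_adjoint ip (diff Om)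
      (fun y => inv_iso (tens_op (adjoint (inv_ip ip) (inv_diff (Om := Om)))
        (fun j => conv (functional_star (chi j)))
        (fun j => adjoint (inv_ip ip) (inv_mul (w j))) (inv_decomp y))).
  move=> wchi; apply: (diff_adjoint hH ipL wchi) => *;
  by apply: adjointP; apply: adj.
have dAdj : adjointable ip (diff Om).
  (* No basis [w] is given yet; the frame [e] of all of Omega^inv provides coefficients as well, and
     [dA] accepts any such family. *)
  have [chi eC _] := coeffs_exist (fun a => eP _).
  pose S y := inv_iso (tens_op (adjoint (inv_ip ip) (inv_diff (Om := Om)))
    (fun j => conv (functional_star (chi j)))
    (fun j => adjoint (inv_ip ip) (inv_mul (e j))) (inv_decomp y)).
  have SL : linear S by move=> k x y; rewrite /S !linearP.
  pose S' : {linear Om -> Om} := HB.pack S (GRing.isLinear.Build _ _ _ _ _ SL).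
  by exists S'; apply: dA.
split=> //; first exact: adjoint_degree (adjointP dAdj).
move=> M w [w1 wO wE].
have [a|chi wchi chiE] := @coeffs_exist _ _ _ ip _ w.
  by apply: orthonormal_expansion => //; apply: wE; apply: diff_inv_deg1.
exists chi; split=> //.
(* Pairing the expansion of P(da) with w_r isolates [chi' r a]. *)
- move=> chi' /diff_coeffsP wchi' r a; rewrite chiE wchi' ip_suml //.
  rewrite (bigD1 r) //= big1 => [|j /negPf jr]; rewrite ipZl // [inv_ip _ _ _]wO.
    by rewrite eqxx mulr1 addr0.
  by rewrite jr mulr0.
- by exists (@inv_decomp _ _ Om); [exact: inv_isoK|exact: inv_decompK].
- exact: diff_inv_iso.
split=> // t.
(* The chosen [adjoint] and the explicit operator are both adjoint to d, hence equal. *)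
have := is_adjoint_uniq ipP (adjointP dAdj) (dA _ _ _ wchi) (inv_iso t).
by rewrite inv_isoK.
Qed.
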